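(* Let $q\in\mathbb{N}$, $\lambda>0$, $0<\theta<1$ and $a_1,\dots,a_q>0$, and let $\{\bar G(t)\}_{t\ge0}$, $\bar G(t)=(G_1(t),\dots,G_q(t))$, be the multivariate gamma subordinator with these parameters (defined in the context). Then for all $i,j\in\{1,\dots,q\}$ and $t\ge0$, $$\operatorname{Cov}(G_i(t),G_j(t))=\frac{\lambda t}{a_ia_j(1-\theta)^2}\big(\theta\, \mathbb{I}_{\{i\ne j\}}+\mathbb{I}_{\{i=j\}}\big),$$ where $\mathbb{I}_A$ denotes the indicator of $A$.
   Context: For $i=1,\dots,q$, $\{Z_i(t)\}_{t\ge0}$ is a gamma Lévy process: $Z_i(0)=0$ and for $t>0$ the variable $Z_i(t)$ has the gamma distribution with shape $\lambda t$ and rate $a_i$, i.e. density $\frac{a_i^{\lambda t}}{\Gamma(\lambda t)}x^{\lambda t-1}e^{-a_ix}$, $x>0$. $\{B^-(\lambda t)\}_{t\ge0}$ is a negative binomial Lévy process with parameter $\theta$: $\Pr\{B^-(\lambda t)=n\}=(1-\theta)^{\lambda t}\binom{n+\lambda t-1}{n}\theta^n$, $n\in\{0,1,2,\dots\}$. The processes $Z_1,\dots,Z_q,B^-$ are mutually independent. The multivariate gamma subordinator is $\bar G(t)=(G_1(t),\dots,G_q(t))$ with $G_i(t)=Z_i\big(t+\lambda^{-1}B^-(\lambda t)\big)$, $t\ge0$; its components are conditionally independent given $\{B^-(\lambda t)\}_{t\ge0}$. *)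

(* Defs.v *)
From HB Require Import structures.
From mathcomp Require Import all_boot all_order all_algebra.
From mathcomp Require Import all_classical all_reals all_analysis.

Set Implicit Arguments.
Unset Strict Implicit.
Unset Printing Implicit Defensive.

Import Order.TTheory GRing.Theory Num.Theory.
Import numFieldNormedType.Exports.

Local Open Scope classical_set_scope.
Local Open Scope ring_scope.

Section independence.
Context {d : measure_display} {T : measurableType d} {R : realType}.
Variable P : probability T R.

Definition mutually_independent (I : finType) (F : I -> set (set T)) : Prop :=
  forall (J : {set I}) (A : I -> set T),
    (forall k, k \in J -> F k (A k)) ->
    P (\bigcap_(k in [set` J]) A k) = (\prod_(k in J) P (A k))%E.

(* Time is the half-line [0, +oo[; the values of a process at negative times
   are junk and never used. *)
Definition process_sigma_algebra {d' : measure_display}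
    {S : measurableType d'} (X : R -> T -> S) : set (set T) :=
  <<s \bigcup_(t in [set t | 0 <= t]) g_sigma_algebra_preimage (X t) >>.

Definition independent_increments (X : R -> T -> R) : Prop :=
  forall (n : nat) (u : nat -> R), 0 <= u 0%N -> nondecreasing_seq u ->
    mutually_independent
      (fun k : 'I_n => g_sigma_algebra_preimage (X (u k.+1) \- X (u k))).

Definition stationary_increments (X : R -> T -> R) : Prop :=
  forall s t : R, 0 <= s -> s <= t -> forall A : set R, measurable A ->
    P ((X t \- X s) @^-1` A) = P (X (t - s) @^-1` A).

Definition stochastically_continuous (X : R -> T -> R) : Prop :=
  forall (t e : R), 0 <= t -> 0 < e ->
    P [set w | e < `|X s w - X t w|] @[s --> within [set s | 0 <= s] (nbhs t)]
      --> 0%E.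

Record levy_process (X : R -> T -> R) : Prop := LevyProcess {
  levy_start : {ae P, forall w, X 0 w = 0} ;
  levy_independent : independent_increments X ;
  levy_stationary : stationary_increments X ;
  levy_continuous : stochastically_continuous X
}.

End independence.

Section distributions.
Context {R : realType}.

Definition gamma_fun (s : R) : R :=
  Rintegral lebesgue_measure `]0, +oo[ (fun x => x `^ (s - 1) * expR (- x)).

Definition gamma_pdf (s a x : R) : R :=
  if 0 < x then a `^ s / gamma_fun s * x `^ (s - 1) * expR (- a * x) else 0.

Definition gamma_law (s a : R) (A : set R) : \bar R :=
  (\int[lebesgue_measure]_(x in A) (gamma_pdf s a x)%:E)%E.

(* binomial coefficient with a real upper argument: x(x-1)...(x-n+1)/n! *)
Definition gbinom (x : R) (n : nat) : R :=
  (\prod_(k < n) (x - k%:R)) / n`!%:R.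

Definition neg_binomial_pmf (s theta : R) (n : nat) : R :=
  (1 - theta) `^ s * gbinom (n%:R + s - 1) n * theta ^+ n.

End distributions.

Section processes.
Context {d : measure_display} {T : measurableType d} {R : realType}.
Variable P : probability T R.

Record gamma_process (lambda a : R) (Z : R -> {RV P >-> R}) : Prop :=
  GammaProcess {
    gamma_levy : levy_process P (fun t w => Z t w) ;
    gamma_marginal : forall t : R, 0 < t -> forall A : set R, measurable A ->
      distribution P (Z t) A = gamma_law (lambda * t) a A
  }.

(* N s is the process B^- at its own time s, so B^-(lambda t) is
   N (lambda * t). *)
Record neg_binomial_process (theta : R) (N : R -> {RV P >-> nat}) : Prop :=
  NegBinomialProcess {
    nb_levy : levy_process P (fun s w => (N s w)%:R : R) ;
    nb_marginal : forall s : R, 0 <= s -> forall n : nat,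
      distribution P (N s) [set n] = (neg_binomial_pmf s theta n)%:E
  }.

Definition independent_processes (q : nat) (Z : 'I_q -> R -> {RV P >-> R})
    (N : R -> {RV P >-> nat}) : Prop :=
  mutually_independent P (fun k : option 'I_q =>
    if k is Some i then process_sigma_algebra (fun t w => Z i t w)
    else process_sigma_algebra (fun s w => N s w)).

Definition gamma_subordinator (q : nat) (lambda : R)
    (Z : 'I_q -> R -> {RV P >-> R}) (N : R -> {RV P >-> nat})
    (i : 'I_q) (t : R) (w : T) : R :=
  Z i (t + lambda^-1 * (N (lambda * t) w)%:R) w.

Lemma measurable_gamma_subordinator (q : nat) (lambda : R)
    (Z : 'I_q -> R -> {RV P >-> R}) (N : R -> {RV P >-> nat})
    (i : 'I_q) (t : R) :
  measurable_fun setT (gamma_subordinator lambda Z N i t).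
Proof.
move=> _ A mA; rewrite setTI.
rewrite (_ : _ @^-1` A = \bigcup_n (N (lambda * t) @^-1` [set n] `&`
    Z i (t + lambda^-1 * n%:R) @^-1` A)); last first.
  apply/seteqP; split=> w /=.
    by move=> Aw; exists (N (lambda * t) w).
  by move=> [n _ [/= <-]].
apply: bigcup_measurable => n _; apply: measurableI.
  by rewrite -[X in measurable X]setTI; exact: measurable_funP.
by rewrite -[X in measurable X]setTI; exact: measurable_funP.
Qed.

HB.instance Definition _ (q : nat) (lambda : R)
    (Z : 'I_q -> R -> {RV P >-> R}) (N : R -> {RV P >-> nat})
    (i : 'I_q) (t : R) :=
  isMeasurableFun.Build _ _ T R (gamma_subordinator lambda Z N i t)
    (measurable_gamma_subordinator lambda Z N i t).

End processes.

(* Main.v *)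
Require Import Defs.
From HB Require Import structures.
From mathcomp Require Import all_boot all_order all_algebra.
From mathcomp Require Import all_classical all_reals all_analysis.
From mathcomp Require Import measurable_realfun ring.

Set Implicit Arguments.
Unset Strict Implicit.
Unset Printing Implicit Defensive.

Import Order.TTheory GRing.Theory Num.Theory.
Import numFieldNormedType.Exports.

Local Open Scope classical_set_scope.
Local Open Scope ring_scope.

(** Conditioning on [B^-(lambda t) = n] freezes the clock of every [Z_i] at
    [s_n = t + n / lambda], where the moments are [E Z_i = r_n / a_i] and
    [E Z_i^2 = r_n (r_n + 1) / a_i^2] with [r_n = lambda s_n = lambda t + n];
    they follow from the recursion [a E Z^(k+1) = (r_n + k) E Z^k], an
    integration by parts.  With [r = lambda t], only the averages of [r + n],
    [(r + n)(r + n + 1)] and [(r + n)^2] over the negative binomial law remain.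
    The third is the difference of the other two, and the identity
    [(r + n) p_r(n) = r / (1 - theta) p_(r+1)(n)] turns those
    two into total masses of the laws with parameters [r + 1] and [r + 2],
    which are 1 because the process has a law at every time.  All integrals
    are computed for absolute values, so that no integrability is needed before
    the end, and signs are restored almost everywhere. *)

(** * Integration against a law given by a density *)

Lemma ge0_integral_density d (T : measurableType d) (R : realType)
    (nu : {finite_measure set T -> \bar R})
    (mu : {sigma_finite_measure set T -> \bar R}) (p h : T -> \bar R) :
  measurable_fun [set: T] p -> (forall x, 0 <= p x)%E ->
  (forall A, measurable A -> nu A = \int[mu]_(x in A) p x)%E ->
  measurable_fun [set: T] h -> (forall x, 0 <= h x)%E ->
  (\int[nu]_x h x = \int[mu]_x (h x * p x))%E.
Proof.
move=> mp p0 nuE mh h0.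
(* Absolute continuity gives a Radon-Nikodym derivative. It has the same integral as [p] over every
   measurable set, so the two agree almost everywhere, and the change of variables known for the
   derivative passes to [p]. *)
have numu : nu `<< mu.
  apply/null_content_dominatesP => A mA muA0.
  by rewrite nuE//; apply: null_set_integral => //; exact: measurable_funTS.
rewrite -(Radon_Nikodym_SigmaFinite.change_of_variables numu)//.
have ip : mu.-integrable setT p.
  apply/integrableP; split => //.
  under eq_integral do rewrite gee0_abs//.
  by rewrite -nuE// ltey_eq fin_num_measure.
have ig := Radon_Nikodym_SigmaFinite.f_integrable numu.
have mg := measurable_int _ ig.
apply: ae_eq_integral => //; [exact: emeasurable_funM..|].
apply: ae_eqe_mul2l.
apply: integral_ae_eq => // A _ mA.
by rewrite -Radon_Nikodym_SigmaFinite.f_integral// nuE.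
Qed.

(** * Integration by parts for [x^p e^(-ax)] on the half-line *)

Section gamma_integral.
Context {R : realType}.
Notation mu := (@lebesgue_measure R).
Implicit Types a p x : R.

Lemma is_derive_powR_expR a p x : 0 < x ->
  is_derive x 1 (fun y : R => y `^ p * expR (- a * y))
    (p * (x `^ (p - 1) * expR (- a * x)) - a * (x `^ p * expR (- a * x))).
Proof.
move=> x0.
have d1 := is_derive1_powR p x0.
by apply: is_derive_eq; rewrite /GRing.scale /=; ring.
Qed.

Lemma cvg0_powR_expR a p : 0 < p ->
  (x `^ p * expR (- a * x) @[x --> 0^'+] --> 0).
Proof.
move=> p0; rewrite -[X in _ --> X](mul0r (expR (- a * 0))).
apply: cvgM; first exact: powR_cvg0.
apply: cvg_at_right_filter; apply: continuous_comp; last exact: continuous_expR.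
by apply: continuousM => //; exact: cst_continuous.
Qed.

(** The quadratic bound [e^y >= 1 + y^2 / 2] beats the linear factor. The limit is one-sided, by
    positivity of the function, so that it composes with the right limit at 0 of a real power. *)
Lemma cvgy_mul_expR a : 0 < a -> (x * expR (- a * x) @[x --> +oo] --> 0^'+).
Proof.
move=> a0.
have f0 : x * expR (- a * x) @[x --> +oo] --> 0.
  apply/cvgrPdist_le => e e0; near=> x.
  have x0 : 0 < x by near: x; exact: nbhs_pinfty_gt.
  (* This threshold is equivalent to [x <= e (ax)^2 / 2] for positive [x]. *)
  have xe : 2 / (e * a ^+ 2) <= x by near: x; apply: nbhs_pinfty_ge; exact: num_real.
  rewrite sub0r normrN ger0_norm ?mulr_ge0 ?expR_ge0 ?(ltW x0)//.
  rewrite mulNr expRN ler_pdivrMr ?expR_gt0//.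
  have ax0 : 0 <= a * x by rewrite mulr_ge0 ?ltW.
  have xle : x <= e * (1 + (a * x) ^+ 2 / 2).
    rewrite ler_pdivrMr in xe; last by rewrite mulr_gt0// exprn_gt0.
    rewrite mulrDr mulr1; apply: (@le_trans _ _ (e * ((a * x) ^+ 2 / 2))).
      have -> : e * ((a * x) ^+ 2 / 2) = x * (x * (e * a ^+ 2)) / 2 by field.
      by rewrite ler_pdivlMr// ler_pM2l.
    by rewrite lerDr ltW.
  by apply: (le_trans xle); rewrite ler_pM2l//; exact: (expR_ge1Dxn 1).
move=> A /f0 fA.
suff : \forall x \near +oo, A (x * expR (- a * x)) by [].
near=> x.
have : 0 < x * expR (- a * x).
  by rewrite mulr_gt0 ?expR_gt0//; near: x; exact: nbhs_pinfty_gt.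
by near: x; exact: fA.
Unshelve. all: by end_near. Qed.

(** Since [x^p e^(-ax) = (x e^(-(a/p) x))^p], the case of exponent 1 with rate [a / p] suffices. *)
Lemma cvgy_powR_expR a p : 0 < a -> 0 < p ->
  (x `^ p * expR (- a * x) @[x --> +oo] --> 0).
Proof.
move=> a0 p0; have ap0 : 0 < a / p by exact: divr_gt0.
have := cvg_comp _ _ (cvgy_mul_expR ap0) (powR_cvg0 p0).
apply: cvg_trans; apply: near_eq_cvg; near=> x => /=.
have x0 : 0 < x by near: x; exact: nbhs_pinfty_gt.
rewrite powRM ?expR_ge0 ?ltW//; congr (_ * _).
by rewrite -expRM; congr expR; field; rewrite gt_eqF.
Unshelve. all: by end_near. Qed.

Lemma measurable_powR_expR a p :
  measurable_fun [set: R] (fun x => x `^ p * expR (- a * x)).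
Proof.
apply: measurable_funM; first exact: measurable_powR.
by apply: measurableT_comp => //; exact: mulrl_measurable.
Qed.

(** This is the fundamental theorem of calculus for [x^p e^(-ax)]. Taking [u > 0] keeps away from
    the singularity of [x^(p-1)] at 0 when [p < 1]. *)
Lemma integral_powR_expR_itv a p (u v : R) : 0 < u -> u < v ->
  (p%:E * \int[mu]_(x in `[u, v]) (x `^ (p - 1) * expR (- a * x))%:E =
   a%:E * \int[mu]_(x in `[u, v]) (x `^ p * expR (- a * x))%:E +
   (v `^ p * expR (- a * v) - u `^ p * expR (- a * u))%:E)%E.
Proof.
move=> u0 uv.
have dF r x : 0 < x -> derivable (fun y : R => y `^ r * expR (- a * y)) x 1.
  by move=> x0; have [] := is_derive_powR_expR a r x0.
have cF r : {within `[u, v], continuous (fun y : R => y `^ r * expR (- a * y))}.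
  apply: derivable_within_continuous => x; rewrite in_itv/= => /andP[ux _].
  exact: dF (lt_le_trans u0 ux).
have iF r : mu.-integrable `[u, v] (fun x => (x `^ r * expR (- a * x))%:E).
  by apply: continuous_compact_integrable => //; exact: segment_compact.
have iZ k r : mu.-integrable `[u, v]
    (fun x => (k * (x `^ r * expR (- a * x)))%:E).
  by apply: (@integrableZl _ _ _ mu _ _ k _ (iF r)); exact: measurable_itv.
have iE k r : (\int[mu]_(x in `[u, v]) (k * (x `^ r * expR (- a * x)))%:E =
    k%:E * \int[mu]_(x in `[u, v]) (x `^ r * expR (- a * x))%:E)%E.
  by rewrite -integralZl//; apply: eq_integral => x _; rewrite EFinM.
have fE r : (\int[mu]_(x in `[u, v]) (x `^ r * expR (- a * x))%:E)%E \is a fin_num.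
  exact: integrable_fin_num.
rewrite EFinB -(@continuous_FTC2 R
  (fun x => p * (x `^ (p - 1) * expR (- a * x)) - a * (x `^ p * expR (- a * x)))
  (fun x => x `^ p * expR (- a * x)) u v uv).
- under [X in (_ + X)%E]eq_integral do rewrite EFinB.
  rewrite integralB_EFin//; [|exact: iZ..].
  rewrite [X in (_ + (X - _))%E](iE p (p - 1)) [X in (_ + (_ - X))%E](iE a p).
  by rewrite addeC subeK// fin_numM.
- apply: derivable_within_continuous => x; rewrite in_itv/= => /andP[ux _].
  have x0 := lt_le_trans u0 ux.
  by apply: derivableB; apply: derivableM => //; exact: dF.
- split.
  + by move=> x; rewrite in_itv/= => /andP[ux _]; exact: dF (lt_trans u0 ux).
  + by have /continuous_within_itvP[] := cF p.
  + by have /continuous_within_itvP[] := cF p.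
- move=> x; rewrite in_itv/= => /andP[ux _].
  have x0 := lt_trans u0 ux.
  have D := is_derive_powR_expR a p x0.
  by rewrite derive1E derive_val.
Qed.

(** The half-line is exhausted by compact intervals, along which the boundary terms vanish. Monotone
    convergence gives both limits in the extended reals, so neither integral has to be known
    finite. *)
Lemma integral_powR_expR_rec a p : 0 < a -> 0 < p ->
  (p%:E * \int[mu]_(x in `]0%R, +oo[) (x `^ (p - 1) * expR (- a * x))%:E =
   a%:E * \int[mu]_(x in `]0%R, +oo[) (x `^ p * expR (- a * x))%:E)%E.
Proof.
move=> a0 p0.
(* Starting at 2 makes the endpoints distinct for every [n]: [1/(n+2) < 1 < n+2]. *)
pose S n := `[n.+2%:R^-1, n.+2%:R : R]%classic.
have ndS : nondecreasing_seq S.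
  move=> m n mn; rewrite subsetEset; apply: subset_itv; rewrite bnd_simp.
    by rewrite lef_pV2 ?posrE ?ltr0n// ler_nat !ltnS.
  by rewrite ler_nat !ltnS.
have SE : \bigcup_n S n = `]0, +oo[%classic.
  apply/seteqP; split=> [x [n _]|x].
    rewrite /S /= !in_itv/= andbT => /andP[nx _].
    by rewrite (lt_le_trans _ nx)// invr_gt0 ltr0n.
  rewrite /= in_itv/= andbT => x0.
  have [n nx] : exists n : nat, Num.max x x^-1 <= n.+2%:R.
    exists (Num.truncn (Num.max x x^-1)).
    by rewrite (le_trans (ltW (truncnS_gt _)))// ler_nat.
  exists n => //; rewrite /S /= in_itv/=; move: nx; rewrite ge_max => /andP[-> nx].
  by rewrite andbT invf_ple ?posrE ?ltr0n.
have cvgS r : (\int[mu]_(x in S n) (x `^ r * expR (- a * x))%:E @[n --> \oo] -->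
    \int[mu]_(x in `]0%R, +oo[) (x `^ r * expR (- a * x))%:E)%E.
  rewrite -SE; apply: ge0_nondecreasing_set_cvg_integral => //.
  - by move=> n; exact: measurable_itv.
  - by move=> n; apply/measurable_EFinP/measurable_funTS; exact: measurable_powR_expR.
  - by move=> n x _; rewrite lee_fin mulr_ge0 ?powR_ge0 ?expR_ge0.
pose F x := x `^ p * expR (- a * x).
have cvgF : (F n.+2%:R - F n.+2%:R^-1) @[n --> \oo] --> (0 : R).
  rewrite -[X in _ --> X](subr0 0); apply: cvgB.
    apply: cvg_comp (cvgy_powR_expR a0 p0).
    by have := @cvgr_idn R; rewrite -cvg_shiftS -cvg_shiftS.
  (* The limit at 0 is a right limit, so the convergence of [1/(n+2)] to 0 has to be combined with
     its positivity. *)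
  apply: cvg_comp (cvg0_powR_expR a p0) => A.
  have := @cvg_harmonic R; rewrite -cvg_shiftS => /[apply] hA.
  have {}hA : \forall n \near \oo, 0 < n.+2%:R^-1 :> R -> A n.+2%:R^-1 by [].
  suff : \forall n \near \oo, A n.+2%:R^-1 by [].
  by apply: filterS hA => n; apply; rewrite invr_gt0 ltr0n.
have e1 : (p%:E * \int[mu]_(x in S n) (x `^ (p - 1) * expR (- a * x))%:E @[n --> \oo] -->
    p%:E * \int[mu]_(x in `]0%R, +oo[) (x `^ (p - 1) * expR (- a * x))%:E)%E.
  by apply: cvgeZl => //; exact: cvgS.
have e2 : (a%:E * \int[mu]_(x in S n) (x `^ p * expR (- a * x))%:E +
   (F n.+2%:R - F n.+2%:R^-1)%:E @[n --> \oo] -->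
    a%:E * \int[mu]_(x in `]0%R, +oo[) (x `^ p * expR (- a * x))%:E + 0%:E)%E.
  apply: cvgeD; first by rewrite fin_num_adde_defl.
    by apply: cvgeZl => //; exact: cvgS.
  by apply: cvg_EFin; [exact: nearW|exact: cvgF].
rewrite -[RHS]adde0; apply: cvg_unique e1 _ => //.
apply: cvg_trans e2; apply: near_eq_cvg; apply: nearW => n.
rewrite integral_powR_expR_itv ?invr_gt0 ?ltr0n//.
by rewrite (@lt_trans _ _ 1) ?invf_lt1 ?ltr0n// ltr1n.
Qed.
End gamma_integral.

(** * Absolute moments of the gamma distribution *)

Section gamma_law.
Context {R : realType}.
Notation mu := (@lebesgue_measure R).
Variables s a : R.

Lemma gamma_fun_ge0 : 0 <= gamma_fun s.
Proof. by apply: Rintegral_ge0 => x _; rewrite mulr_ge0 ?powR_ge0 ?expR_ge0. Qed.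

Lemma gamma_pdf_ge0 (x : R) : 0 <= gamma_pdf s a x.
Proof.
rewrite /gamma_pdf; case: ifPn => // _.
by rewrite !mulr_ge0 ?invr_ge0 ?powR_ge0 ?expR_ge0 ?gamma_fun_ge0.
Qed.

Lemma gamma_pdf_patchE : gamma_pdf s a =
  (fun x => a `^ s / gamma_fun s * (x `^ (s - 1) * expR (- a * x))) \_ `]0, +oo[.
Proof.
apply/funext => x; rewrite patchE /gamma_pdf mem_setE in_itv/= andbT.
by case: ifPn => // _; rewrite mulrA.
Qed.

Lemma measurable_gamma_pdf : measurable_fun [set: R] (gamma_pdf s a).
Proof.
rewrite gamma_pdf_patchE; apply/measurable_restrict => //; apply: measurable_funTS.
by apply: measurable_funM => //; exact: measurable_powR_expR.
Qed.

Lemma integral_pow_gamma_pdf (k : nat) :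
  (\int[mu]_x ((`|x| ^+ k)%:E * (gamma_pdf s a x)%:E) =
   (a `^ s / gamma_fun s)%:E *
     \int[mu]_(x in `]0%R, +oo[) (x `^ (s + k%:R - 1) * expR (- a * x))%:E)%E.
Proof.
rewrite -ge0_integralZl//.
- rewrite [RHS]integral_mkcond; apply: eq_integral => x _.
  rewrite patchE mem_setE in_itv/= andbT /gamma_pdf.
  case: ifPn => [x0|_]; last by rewrite mule0.
  rewrite -!EFinM gtr0_norm// -(@powR_mulrn _ x k) ?ltW//; congr EFin.
  rewrite addrAC (@powRD _ x (s - 1)); last by rewrite (gt_eqF x0) implybT.
  by ring.
- by apply/measurable_EFinP/measurable_funTS; exact: measurable_powR_expR.
- by move=> x _; rewrite lee_fin mulr_ge0 ?powR_ge0 ?expR_ge0.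
- by rewrite lee_fin mulr_ge0 ?invr_ge0 ?powR_ge0 ?gamma_fun_ge0.
Qed.

End gamma_law.

Section gamma_moments.
Context d (T : measurableType d) {R : realType} (P : probability T R).
Notation mu := (@lebesgue_measure R).
Variables (s a : R) (X : {RV P >-> R}).
Hypotheses (s0 : 0 < s) (a0 : 0 < a).
Hypothesis lawX : forall A, measurable A -> distribution P X A = gamma_law s a A.

Lemma gamma_ae_ge0 : {ae P, forall w, 0 <= X w}.
Proof.
pose A : set R := [set x | x < 0].
have mA : measurable A by rewrite /A -set_itvNyo; exact: measurable_itv.
exists (X @^-1` A); split.
- by rewrite -[X in measurable X]setTI; exact: measurable_funP.
- rewrite -[LHS]/(distribution P X A) lawX// /gamma_law.
  apply: integral0_eq => x x0.
  by rewrite /gamma_pdf ltNge ltW.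
- by move=> w /=; rewrite /A /= ltNge => /negP.
Qed.

Lemma gamma_abs_momentE (k : nat) : (\int[P]_w (`|X w| ^+ k)%:E =
   (a `^ s / gamma_fun s)%:E *
     \int[mu]_(x in `]0%R, +oo[) (x `^ (s + k%:R - 1) * expR (- a * x))%:E)%E.
Proof.
rewrite -integral_pow_gamma_pdf.
(* [R] and [measurableTypeR R], the domain of the Lebesgue measure, have the
   same measurable sets but distinct displays. *)
have mX : measurable_fun [set: T] (X : T -> measurableTypeR R).
  by move=> mT A mA; exact: (@measurable_funP _ _ _ _ _ X mT A mA).
pose X' : {mfun T >-> measurableTypeR R} :=
  HB.pack (X : T -> measurableTypeR R) (isMeasurableFun.Build _ _ _ _ _ mX).
have mk : measurable_fun [set: measurableTypeR R] (fun x : R => (`|x| ^+ k)%:E).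
  by apply/measurable_EFinP/measurable_funX; exact: normr_measurable.
rewrite -[LHS](@ge0_integral_distribution _ _ _ _ _ _ X' (fun x : R => (`|x| ^+ k)%:E))//.
  apply: ge0_integral_density => //.
  - by apply/measurable_EFinP; exact: measurable_gamma_pdf.
  - by move=> x; rewrite lee_fin gamma_pdf_ge0.
Qed.

(** Both moments carry the same factor [a^s / Gamma(s)], so only the recursion for the integrals
    matters. The constant is never evaluated: the recursion will start from the zeroth moment, which
    is the total mass of [P]. *)
Lemma gamma_abs_moment_rec (k : nat) :
  (\int[P]_w (`|X w| ^+ k.+1)%:E =
   ((s + k%:R) / a)%:E * \int[P]_w (`|X w| ^+ k)%:E)%E.
Proof.
rewrite !gamma_abs_momentE muleCA.
have sk0 : 0 < s + k%:R by rewrite ltr_pwDl.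
rewrite [in RHS](mulrC _ a^-1) (EFinM a^-1) -(muleA a^-1%:E) integral_powR_expR_rec//.
rewrite [(a^-1%:E * _)%E]muleA -EFinM mulVf ?gt_eqF// mul1e.
by rewrite -natr1 addrA addrK.
Qed.

Lemma gamma_abs_moment1 : (\int[P]_w (`|X w| ^+ 1)%:E = (s / a)%:E)%E.
Proof.
rewrite gamma_abs_moment_rec addr0.
under eq_integral do rewrite expr0.
by rewrite integral_cst//= probability_setT !mule1.
Qed.

Lemma gamma_abs_moment2 :
  (\int[P]_w (`|X w| ^+ 2)%:E = (s * (s + 1) / a ^+ 2)%:E)%E.
Proof.
rewrite gamma_abs_moment_rec gamma_abs_moment1 -EFinM; congr EFin.
by field; rewrite gt_eqF.
Qed.

End gamma_moments.

(** * Integrals over an event independent of the integrand *)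

Lemma ge0_integral_mrestr d (T : measurableType d) (R : realType)
    (mu : {measure set T -> \bar R}) (E : set T) (mE : measurable E)
    (f : T -> \bar R) :
  measurable_fun [set: T] f -> (forall x, 0 <= f x)%E ->
  (\int[mrestr mu mE]_x f x = \int[mu]_(x in E) f x)%E.
Proof.
move=> mf f0.
rewrite -(setUv E) ge0_integral_setU//; last 3 first.
- exact: measurableC.
- by rewrite setUv.
- exact/disj_setPCl.
rewrite [X in (_ + X)%E]null_set_integral ?adde0//; last 3 first.
- exact: measurableC.
- exact: measurable_funTS.
- by rewrite /= /mrestr setICl measure0.
by apply: eq_measure_integral => A mA AE; rewrite /= /mrestr setIidl.
Qed.

Section independent_integral.
Context d {T : measurableType d} {R : realType} (P : probability T R).
Variables (E : set T) (mE : measurable E).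

(** Independence says that the image under [X] of [P] restricted to [E] is the law of [X] scaled by
    [P E]; both sides integrate [f] against this one measure. *)
Lemma ge0_integral_indep (X : {RV P >-> R}) (f : R -> \bar R) :
  (forall A, measurable A ->
    P (E `&` X @^-1` A) = P E * P (X @^-1` A))%E ->
  measurable_fun [set: R] f -> (forall x, 0 <= f x)%E ->
  (\int[P]_(w in E) f (X w) = P E * \int[P]_w f (X w))%E.
Proof.
move=> indX mf f0.
have PE0 : 0 <= fine (P E) by exact: fine_ge0.
pose m := mscale (NngNum PE0) (distribution P X).
transitivity (\int[m]_x f x)%E; last first.
  rewrite ge0_integral_mscale//= fineK ?fin_num_measure//.
  by rewrite ge0_integral_distribution.
rewrite -(ge0_integral_mrestr _ mE)//; last exact: measurableT_comp.
rewrite -[LHS](@ge0_integral_pushforward _ _ _ _ _ X _ _ setT f)//.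
apply: eq_measure_integral => A mA _.
by rewrite /m /= /mscale/= /mrestr/= /pushforward setIC indX// fineK ?fin_num_measure.
Qed.

(** The image of the restricted [P] under [(X, Y)] agrees on rectangles with the product of the two
    laws, the first scaled by [P E]. Uniqueness of the product measure identifies the two, and
    Tonelli separates the factors. *)
Lemma ge0_integral_indep2 (X Y : {RV P >-> R}) (f g : R -> \bar R) :
  (forall A B, measurable A -> measurable B ->
    P (E `&` (X @^-1` A `&` Y @^-1` B)) =
    P E * (P (X @^-1` A) * P (Y @^-1` B)))%E ->
  measurable_fun [set: R] f -> (forall x, 0 <= f x)%E ->
  measurable_fun [set: R] g -> (forall x, 0 <= g x)%E ->
  (\int[P]_(w in E) (f (X w) * g (Y w)) =
   P E * (\int[P]_w f (X w) * \int[P]_w g (Y w)))%E.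
Proof.
move=> indXY mf f0 mg g0.
have PE0 : 0 <= fine (P E) by exact: fine_ge0.
pose m := mscale (NngNum PE0) (distribution P X).
have mXY : measurable_fun [set: T] (fun w => (X w, Y w)).
  exact/measurable_fun_pairP.
pose XY : {mfun T >-> (R * R)%type} :=
  HB.pack (fun w => (X w, Y w)) (isMeasurableFun.Build _ _ _ _ _ mXY).
have mfg : measurable_fun [set: R * R] (fun z => f z.1 * g z.2)%E.
  by apply: emeasurable_funM; exact: measurableT_comp.
have fg0 z : (0 <= f z.1 * g z.2)%E by rewrite mule_ge0.
rewrite -(ge0_integral_mrestr _ mE); last 2 first.
- exact: (measurableT_comp mfg mXY).
- by move=> w; rewrite mule_ge0.
rewrite -[LHS](@ge0_integral_pushforward _ _ _ _ _ XY _ _ setT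
  (fun z => f z.1 * g z.2)%E)//.
transitivity (\int[m \x distribution P Y]_z (f z.1 * g z.2))%E.
  apply: eq_measure_integral => A mA _; apply/esym.
  apply: (@product_measure_unique _ _ _ _ _ m (distribution P Y)
    (pushforward (mrestr P mE) XY)) => //.
  move=> B C mB mC.
  rewrite /m /= /mscale/= /mrestr/= /pushforward fineK ?fin_num_measure//.
  by rewrite setIC -muleA -indXY.
rewrite (fubini_tonelli1 (fun z => f z.1 * g z.2)%E)//.
under eq_integral => x _.
  rewrite /fubini_F/= ge0_integralZl//.
  over.
rewrite ge0_integralZr//; last by rewrite integral_ge0.
rewrite ge0_integral_mscale//= fineK ?fin_num_measure// -muleA.
by rewrite !ge0_integral_distribution.
Qed.

End independent_integral.

(** * Negative binomial averages *)

Section neg_binomial.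
Context {R : realType}.
Implicit Types (r theta : R) (n : nat).

(** Reversing the order of the factors turns the falling product into a rising factorial, which
    makes its sign and its behaviour under [r -> r + 1] visible. *)
Lemma gbinom_risingE r n :
  gbinom (n%:R + r - 1) n = (\prod_(k < n) (r + k%:R)) / n`!%:R.
Proof.
rewrite /gbinom; congr (_ / _).
rewrite [RHS](reindex_inj rev_ord_inj)/=; apply: eq_bigr => k _.
rewrite natrB; last exact: ltn_ord.
by rewrite -natr1; ring.
Qed.

Lemma gbinom_ge0 r n : 0 <= r -> 0 <= gbinom (n%:R + r - 1) n.
Proof.
move=> r0; rewrite gbinom_risingE divr_ge0 ?ler0n//.
by apply: prodr_ge0 => k _; rewrite addr_ge0.
Qed.

Lemma neg_binomial_pmf_ge0 r theta n : 0 <= r -> 0 <= theta ->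
  0 <= neg_binomial_pmf r theta n.
Proof.
move=> r0 th0; rewrite /neg_binomial_pmf mulr_ge0 ?exprn_ge0//.
by rewrite mulr_ge0 ?powR_ge0//; exact: gbinom_ge0.
Qed.

(** The product [r (r+1) ... (r+n)] can be split off at either end; the power of [1 - theta] then
    accounts for the denominator. *)
Lemma neg_binomial_pmf_shift r theta n : theta < 1 ->
  (r + n%:R) * neg_binomial_pmf r theta n =
  r / (1 - theta) * neg_binomial_pmf (r + 1) theta n.
Proof.
move=> th1; have th0 : 1 - theta != 0 by rewrite gt_eqF// subr_gt0.
rewrite /neg_binomial_pmf !gbinom_risingE powRD ?th0 ?implybT//.
rewrite powRr1 ?subr_ge0 ?ltW//.
have prodE : (r + n%:R) * \prod_(k < n) (r + k%:R) =
    r * \prod_(k < n) (r + 1 + k%:R).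
  transitivity (\prod_(k < n.+1) (r + k%:R)).
    by rewrite big_ord_recr/= mulrC.
  rewrite big_ord_recl/= addr0.
  by congr (_ * _); apply: eq_bigr => k _; rewrite /bump/= natrD addrA.
transitivity ((1 - theta) `^ r * ((r + n%:R) * \prod_(k < n) (r + k%:R))
    / n`!%:R * theta ^+ n); first by ring.
by rewrite prodE; field; rewrite th0 pnatr_eq0 -lt0n fact_gt0.
Qed.

Context d {T : measurableType d} (P : probability T R).
Variables (theta : R) (N : R -> {RV P >-> nat}).
Hypotheses (theta_gt0 : 0 < theta) (theta_lt1 : theta < 1).
Hypothesis N_nb : neg_binomial_process theta N.

Lemma neg_binomial_pmf_sum r : 0 <= r ->
  (\sum_(n <oo) (neg_binomial_pmf r theta n)%:E = 1)%E.
Proof.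
move=> r0; rewrite -(probability_setT (distribution P (N r))).
rewrite (_ : [set: nat] = \bigcup_n [set n]); last first.
  by apply/seteqP; split => // n _; exists n.
rewrite measure_bigcup//; last by move=> m n _ _ [x [/= -> ->]].
rewrite [RHS](@eq_eseriesl _ _ xpredT) => [|n]; last by rewrite in_setT.
by apply: eq_eseriesr => n _; exact/esym/(nb_marginal N_nb).
Qed.

Lemma neg_binomial_rising_moment1 r : 0 <= r ->
  (\sum_(n <oo) ((r + n%:R) * neg_binomial_pmf r theta n)%:E =
   (r / (1 - theta))%:E)%E.
Proof.
move=> r0; have r10 : 0 <= r + 1 by rewrite addr_ge0.
under eq_eseriesr do rewrite neg_binomial_pmf_shift// EFinM.
rewrite nneseriesZl ?neg_binomial_pmf_sum ?mule1//.
by move=> n _; rewrite lee_fin neg_binomial_pmf_ge0// ltW.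
Qed.

Lemma neg_binomial_rising_moment2 r : 0 <= r ->
  (\sum_(n <oo) ((r + n%:R) * (r + n%:R + 1) * neg_binomial_pmf r theta n)%:E =
   (r * (r + 1) / (1 - theta) ^+ 2)%:E)%E.
Proof.
move=> r0; have r10 : 0 <= r + 1 by rewrite addr_ge0.
have th0 : 1 - theta != 0 by rewrite gt_eqF// subr_gt0.
(* One shift leaves the first rising moment at parameter [r + 1]. *)
transitivity (\sum_(n <oo) ((r / (1 - theta))%:E *
    ((r + 1 + n%:R) * neg_binomial_pmf (r + 1) theta n)%:E))%E.
  apply: eq_eseriesr => n _; rewrite -EFinM; congr EFin.
  by rewrite (mulrCA (r / _)) -neg_binomial_pmf_shift//; ring.
rewrite nneseriesZl ?neg_binomial_rising_moment1//.
  by rewrite -EFinM; congr EFin; field.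
by move=> n _; rewrite lee_fin mulr_ge0 ?addr_ge0// neg_binomial_pmf_ge0// ltW.
Qed.

Lemma neg_binomial_shifted_moment2 r : 0 <= r ->
  (\sum_(n <oo) ((r + n%:R) ^+ 2 * neg_binomial_pmf r theta n)%:E =
   (r * (r + theta) / (1 - theta) ^+ 2)%:E)%E.
Proof.
move=> r0; have th0 : 1 - theta != 0 by rewrite gt_eqF// subr_gt0.
have pmf0 n : 0 <= neg_binomial_pmf r theta n.
  by rewrite neg_binomial_pmf_ge0// ltW.
have := neg_binomial_rising_moment2 r0.
rewrite (eq_eseriesr (g := fun n => ((r + n%:R) ^+ 2 * neg_binomial_pmf r theta n)%:E +
  ((r + n%:R) * neg_binomial_pmf r theta n)%:E)%E); last first.
  by move=> n _; rewrite -EFinD; congr EFin; ring.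
rewrite nneseriesD; last 2 first.
- by move=> n _ _; rewrite lee_fin mulr_ge0 ?exprn_ge0 ?addr_ge0.
- by move=> n _ _; rewrite lee_fin mulr_ge0 ?addr_ge0.
rewrite neg_binomial_rising_moment1// => e.
(* The first moment is finite, so it can be cancelled in the extended reals. *)
rewrite -[LHS](@addeK _ (r / (1 - theta))%:E)// e -EFinB; congr EFin.
by field.
Qed.

End neg_binomial.

(** A finite absolute integral gives integrability, and almost sure nonnegativity makes the
    expectation equal to it. *)
Lemma Lfun1_ae_ge0 d (T : measurableType d) (R : realType)
    (P : probability T R) (X : T -> R) (c : R) :
  measurable_fun [set: T] X -> {ae P, forall w, 0 <= X w} ->
  (\int[P]_w `|X w|%:E = c%:E)%E ->
  X \in Lfun P 1 /\ ('E_P[X] = c%:E)%E.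
Proof.
move=> mX X0 absX; split.
  apply/Lfun1_integrable/integrableP; split; first exact/measurable_EFinP.
  by under eq_integral do rewrite /=; rewrite absX ltry.
rewrite unlock -absX; apply: ae_eq_integral => //.
- exact/measurable_EFinP.
- by apply/measurable_EFinP; exact: measurableT_comp.
- by apply: filterS X0 => w Xw _; rewrite ger0_norm.
Qed.

(** * Moments of the gamma process, time 0 included *)

Section gamma_process_moments.
Context d {T : measurableType d} {R : realType} (P : probability T R).
Variables (lambda a : R) (Z : R -> {RV P >-> R}).
Hypotheses (lambda_gt0 : 0 < lambda) (a_gt0 : 0 < a).
Hypothesis Z_gamma : gamma_process lambda a Z.

(** The gamma marginal is prescribed at positive times only; at time 0 the sign comes from the
    almost sure start at 0. *)
Lemma gamma_process_ge0 s : 0 <= s -> {ae P, forall w, 0 <= Z s w}.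
Proof.
rewrite le_eqVlt => /predU1P[<-|s0].
  by apply: filterS (levy_start (gamma_levy Z_gamma)) => w ->.
apply: (@gamma_ae_ge0 _ _ _ _ (lambda * s) a).
exact: (gamma_marginal Z_gamma s0).
Qed.

(** The exponent is a successor because [0 ^+ 0] is 1. *)
Lemma gamma_process_abs_moment0 k : (\int[P]_w (`|Z 0 w| ^+ k.+1)%:E = 0)%E.
Proof.
have mZ : measurable_fun [set: T] (fun w => (`|Z 0 w| ^+ k.+1)%:E).
  apply/measurable_EFinP/measurable_funX.
  by apply: measurableT_comp => //; exact: measurable_funP.
rewrite (@ge0_ae_eq_integral _ _ _ _ _ _ (cst 0%E)) ?integral_cst ?mul0e//.
apply: filterS (levy_start (gamma_levy Z_gamma)) => w Zw _.
by rewrite /= Zw normr0 expr0n.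
Qed.

Lemma gamma_process_abs_moment1 s : 0 <= s ->
  (\int[P]_w (`|Z s w| ^+ 1)%:E = (lambda * s / a)%:E)%E.
Proof.
rewrite le_eqVlt => /predU1P[<-|s0].
  by rewrite gamma_process_abs_moment0 mulr0 mul0r.
apply: gamma_abs_moment1 => //; first exact: mulr_gt0.
exact: (gamma_marginal Z_gamma s0).
Qed.

Lemma gamma_process_abs_moment2 s : 0 <= s ->
  (\int[P]_w (`|Z s w| ^+ 2)%:E =
   (lambda * s * (lambda * s + 1) / a ^+ 2)%:E)%E.
Proof.
rewrite le_eqVlt => /predU1P[<-|s0].
  by rewrite gamma_process_abs_moment0 mulr0 !mul0r.
apply: gamma_abs_moment2 => //; first exact: mulr_gt0.
exact: (gamma_marginal Z_gamma s0).
Qed.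

End gamma_process_moments.

(** * The subordinator conditioned on its clock *)

Lemma process_sigma_algebra_preimage d (T : measurableType d) (R : realType)
    d' (S : measurableType d') (X : R -> T -> S) (t : R) (A : set S) :
  0 <= t -> measurable A -> process_sigma_algebra X (X t @^-1` A).
Proof.
move=> t0 mA; apply: sub_gen_smallest; exists t => //.
by exists A => //; rewrite setTI.
Qed.

Section subordinator.
Context d {T : measurableType d} {R : realType} (P : probability T R).
Variables (q : nat) (lambda theta : R) (a : 'I_q -> R).
Variables (Z : 'I_q -> R -> {RV P >-> R}) (N : R -> {RV P >-> nat}).
Hypotheses (lambda_gt0 : 0 < lambda) (theta_gt0 : 0 < theta).
Hypothesis theta_lt1 : theta < 1.
Hypothesis a_gt0 : forall i, 0 < a i.
Hypothesis Z_gamma : forall i, gamma_process lambda (a i) (Z i).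
Hypothesis N_nb : neg_binomial_process theta N.
Hypothesis ZN_indep : independent_processes Z N.
Variables (t : R) (t_ge0 : 0 <= t).

Let r := lambda * t.
Let clock n := t + lambda^-1 * n%:R.
Let E n := N r @^-1` [set n].
Local Notation G := (fun i => gamma_subordinator lambda Z N i t).

Let r_ge0 : 0 <= r. Proof. by rewrite mulr_ge0// ltW. Qed.

Let clock_ge0 n : 0 <= clock n.
Proof. by rewrite addr_ge0// mulr_ge0// invr_ge0 ltW. Qed.

Let lambda_clock n : lambda * clock n = r + n%:R.
Proof. by rewrite /clock mulrDr mulVKf// gt_eqF. Qed.

Let mE n : measurable (E n).
Proof. by rewrite -[X in measurable X]setTI; exact: measurable_funP. Qed.

Let PE n : P (E n) = (neg_binomial_pmf r theta n)%:E.
Proof. exact: (nb_marginal N_nb). Qed.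

Let GE i n w : E n w -> G i w = Z i (clock n) w.
Proof. by rewrite /E /= /gamma_subordinator => ->. Qed.

Let integral_clock (h : T -> \bar R) : measurable_fun [set: T] h ->
  (forall w, 0 <= h w)%E ->
  (\int[P]_w h w = \sum_(n <oo) \int[P]_(w in E n) h w)%E.
Proof.
move=> mh h0.
rewrite (_ : [set: T] = \bigcup_n E n); last first.
  by apply/seteqP; split => // w _; exists (N r w).
rewrite ge0_integral_bigcup//; first exact: measurable_funTS.
by move=> m n _ _ [w [/= <- <-]].
Qed.

Let indep1 i s A n : 0 <= s -> measurable A ->
  (P (E n `&` Z i s @^-1` A) = P (E n) * P (Z i s @^-1` A))%E.
Proof.
move=> s0 mA.
(* The index set used below contains only [None] and [Some i], so every [Some] may carry the event
   of [Z i]. *)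
pose F (k : option 'I_q) := if k is Some _ then Z i s @^-1` A else E n.
have := @ZN_indep [set None; Some i]%SET F.
rewrite big_setU1 ?inE//= big_set1/=.
rewrite (_ : \bigcap_(k in _) _ = E n `&` Z i s @^-1` A).
  apply => -[k|] /=; last by move=> _; exact: process_sigma_algebra_preimage.
  by rewrite !inE/= => /eqP[->]; exact: process_sigma_algebra_preimage.
apply/seteqP; split => w.
  by move=> Fw; split; [apply: (Fw None)|apply: (Fw (Some i))];
    rewrite /= !inE eqxx ?orbT.
by move=> [Ew Zw] [k|].
Qed.

Let indep2 i j s A B n : i != j -> 0 <= s -> measurable A -> measurable B ->
  (P (E n `&` (Z i s @^-1` A `&` Z j s @^-1` B)) =
   P (E n) * (P (Z i s @^-1` A) * P (Z j s @^-1` B)))%E.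
Proof.
move=> ij s0 mA mB.
(* Within the index set [None], [Some i], [Some j], the test [k == i] separates the last two since
   [i != j]. *)
pose F (k : option 'I_q) := if k is Some k then
  if k == i then Z i s @^-1` A else Z j s @^-1` B else E n.
have := @ZN_indep [set None; Some i; Some j]%SET F.
have ji : (j == i) = false by rewrite eq_sym; exact/negbTE.
have Sij : (Some i == Some j :> option 'I_q) = false by exact/negbTE.
rewrite (_ : [set None; Some i; Some j]%SET = (None |: (Some i |: [set Some j]))%SET); last first.
  by rewrite finset.setUA.
rewrite !big_setU1 ?inE/= ?Sij// big_set1/= eqxx ji.
rewrite (_ : \bigcap_(k in _) _ = E n `&` (Z i s @^-1` A `&` Z j s @^-1` B)).
  apply => -[k|] /=; last by move=> _; exact: process_sigma_algebra_preimage.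
  rewrite !inE/= => /orP[|] /eqP[->]; rewrite ?eqxx ?ji;
    exact: process_sigma_algebra_preimage.
apply/seteqP; split => w.
  move=> Fw; split.
    by apply: (Fw None); rewrite /= !inE.
  split.
    by have := Fw (Some i); rewrite /= !inE !eqxx ?orbT; exact.
  by have := Fw (Some j); rewrite /= !inE !eqxx ?orbT ji; exact.
by move=> [Ew [Zi Zj]] [k|]//= _; case: ifP.
Qed.

Let mG i : measurable_fun [set: T] (G i).
Proof. exact: measurable_gamma_subordinator. Qed.

Let mGabs i k : measurable_fun [set: T] (fun w => (`|G i w| ^+ k)%:E).
Proof.
apply/measurable_EFinP/measurable_funX.
by apply: measurableT_comp => //; exact: mG.
Qed.

Let mabs k : measurable_fun [set: R] (fun x : R => (`|x| ^+ k)%:E).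
Proof. by apply/measurable_EFinP/measurable_funX; exact: normr_measurable. Qed.

Let abs_ge0 k (x : R) : (0 <= (`|x| ^+ k)%:E)%E.
Proof. by rewrite lee_fin exprn_ge0. Qed.

(** On [E n] the subordinator is [Z i] at the deterministic time [clock n], which is independent of
    [E n]. *)
Let integral_abs_pow i k : (\int[P]_w (`|G i w| ^+ k)%:E =
  \sum_(n <oo) ((neg_binomial_pmf r theta n)%:E *
                \int[P]_w (`|Z i (clock n) w| ^+ k)%:E))%E.
Proof.
rewrite integral_clock//; apply: eq_eseriesr => n _.
rewrite -PE -(@ge0_integral_indep _ _ _ _ _ (mE n) _ (fun x => (`|x| ^+ k)%:E))//.
  by apply: eq_integral => w /[!inE] Ew; rewrite (GE _ Ew).
by move=> A mA; exact: indep1.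
Qed.

Let integral_abs_mul i j : i != j -> (\int[P]_w (`|G i w| * `|G j w|)%:E =
  \sum_(n <oo) ((neg_binomial_pmf r theta n)%:E *
                (\int[P]_w (`|Z i (clock n) w| ^+ 1)%:E *
                 \int[P]_w (`|Z j (clock n) w| ^+ 1)%:E)))%E.
Proof.
move=> ij; rewrite integral_clock//.
- apply: eq_eseriesr => n _.
  rewrite -PE -(@ge0_integral_indep2 _ _ _ _ _ (mE n) _ _
    (fun x => (`|x| ^+ 1)%:E) (fun x => (`|x| ^+ 1)%:E))//.
    by apply: eq_integral => w /[!inE] Ew; rewrite !(GE _ Ew).
  by move=> A B mA mB; exact: indep2.
- apply/measurable_EFinP/measurable_funM.
    by apply: measurableT_comp => //; exact: mG.
  by apply: measurableT_comp => //; exact: mG.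
Qed.

(** The random time takes only the countably many values [clock n], so one null set serves for all
    of them. *)
Lemma gamma_subordinator_ge0 i : {ae P, forall w, 0 <= G i w}.
Proof.
have := ae_foralln (fun n => gamma_process_ge0 (Z_gamma i) (clock_ge0 n)).
by apply: filterS => w /(_ (N r w)).
Qed.

Lemma gamma_subordinator_abs_moment1 i :
  (\int[P]_w (`|G i w| ^+ 1)%:E = (r / (a i * (1 - theta)))%:E)%E.
Proof.
have ai0 : a i != 0 by rewrite gt_eqF.
have th0 : 1 - theta != 0 by rewrite gt_eqF// subr_gt0.
rewrite integral_abs_pow.
transitivity (\sum_(n <oo) ((a i)^-1%:E *
    ((r + n%:R) * neg_binomial_pmf r theta n)%:E))%E.
  apply: eq_eseriesr => n _.
  rewrite (gamma_process_abs_moment1 lambda_gt0 (a_gt0 i) (Z_gamma i))//.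
  by rewrite lambda_clock -!EFinM; congr EFin; ring.
rewrite nneseriesZl; last first.
  by move=> n _; rewrite lee_fin mulr_ge0 ?addr_ge0// neg_binomial_pmf_ge0// ltW.
rewrite (neg_binomial_rising_moment1 theta_gt0 theta_lt1 N_nb)// -EFinM.
by congr EFin; field; rewrite ai0 th0.
Qed.

Lemma gamma_subordinator_abs_moment2 i :
  (\int[P]_w (`|G i w| ^+ 2)%:E =
   (r * (r + 1) / (a i * (1 - theta)) ^+ 2)%:E)%E.
Proof.
have ai0 : a i != 0 by rewrite gt_eqF.
have th0 : 1 - theta != 0 by rewrite gt_eqF// subr_gt0.
rewrite integral_abs_pow.
transitivity (\sum_(n <oo) ((a i ^- 2)%:E *
    ((r + n%:R) * (r + n%:R + 1) * neg_binomial_pmf r theta n)%:E))%E.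
  apply: eq_eseriesr => n _.
  rewrite (gamma_process_abs_moment2 lambda_gt0 (a_gt0 i) (Z_gamma i))//.
  by rewrite lambda_clock -!EFinM; congr EFin; ring.
rewrite nneseriesZl; last first.
  move=> n _; rewrite lee_fin.
  apply: mulr_ge0; first by rewrite mulr_ge0 ?addr_ge0.
  by rewrite neg_binomial_pmf_ge0// ltW.
rewrite (neg_binomial_rising_moment2 theta_gt0 theta_lt1 N_nb)// -EFinM.
by congr EFin; field; rewrite ai0 th0.
Qed.

Lemma gamma_subordinator_abs_mul i j : i != j ->
  (\int[P]_w (`|G i w| * `|G j w|)%:E =
   (r * (r + theta) / (a i * a j * (1 - theta) ^+ 2))%:E)%E.
Proof.
move=> ij.
have ai0 : a i != 0 by rewrite gt_eqF.
have aj0 : a j != 0 by rewrite gt_eqF.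
have th0 : 1 - theta != 0 by rewrite gt_eqF// subr_gt0.
rewrite integral_abs_mul//.
transitivity (\sum_(n <oo) ((a i * a j)^-1%:E *
    ((r + n%:R) ^+ 2 * neg_binomial_pmf r theta n)%:E))%E.
  apply: eq_eseriesr => n _.
  rewrite (gamma_process_abs_moment1 lambda_gt0 (a_gt0 i) (Z_gamma i))//.
  rewrite (gamma_process_abs_moment1 lambda_gt0 (a_gt0 j) (Z_gamma j))//.
  by rewrite lambda_clock -!EFinM; congr EFin; field; rewrite ai0 aj0.
rewrite nneseriesZl; last first.
  move=> n _; rewrite lee_fin.
  apply: mulr_ge0; first by rewrite exprn_ge0 ?addr_ge0.
  by rewrite neg_binomial_pmf_ge0// ltW.
rewrite (neg_binomial_shifted_moment2 theta_gt0 theta_lt1 N_nb)// -EFinM.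
by congr EFin; field; rewrite ai0 aj0 th0.
Qed.

End subordinator.

(** * Covariance from the first and second moments *)

Theorem proposition3p2 (d : measure_display) (T : measurableType d)
    (R : realType) (P : probability T R) (q : nat) (lambda theta : R)
    (a : 'I_q -> R) (Z : 'I_q -> R -> {RV P >-> R}) (N : R -> {RV P >-> nat})
    (lambda_gt0 : 0 < lambda) (theta_gt0 : 0 < theta) (theta_lt1 : theta < 1)
    (a_gt0 : forall i, 0 < a i)
    (Z_gamma : forall i, gamma_process lambda (a i) (Z i))
    (N_nb : neg_binomial_process theta N)
    (ZN_indep : independent_processes Z N)
    (i j : 'I_q) (t : R) (t_ge0 : 0 <= t) :
  covariance P (gamma_subordinator lambda Z N i t)
      (gamma_subordinator lambda Z N j t)
    = (lambda * t / (a i * a j * (1 - theta) ^+ 2)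
       * (theta * (i != j)%:R + (i == j)%:R))%:E.
Proof.
have a_neq0 k : a k != 0 by rewrite gt_eqF.
have th0 : 1 - theta != 0 by rewrite gt_eqF// subr_gt0.
have mG k := measurable_gamma_subordinator lambda Z N k t.
have G0 k := gamma_subordinator_ge0 N lambda_gt0 Z_gamma t_ge0 k.
have EG k := Lfun1_ae_ge0 (mG k) (G0 k) (gamma_subordinator_abs_moment1
  lambda_gt0 theta_gt0 theta_lt1 a_gt0 Z_gamma N_nb ZN_indep t_ge0 k).
have [GiL EGi] := EG i; have [GjL EGj] := EG j.
have mGG : measurable_fun [set: T]
    (gamma_subordinator lambda Z N i t * gamma_subordinator lambda Z N j t).
  exact: measurable_funM.
have GG0 : {ae P, forall w, 0 <= (gamma_subordinator lambda Z N i t *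
    gamma_subordinator lambda Z N j t) w}.
  by apply: filterS2 (G0 i) (G0 j) => w Gi Gj; exact: mulr_ge0.
(* Given the clock, distinct components are independent, while equal ones contribute a genuine
   second moment. *)
have [eq_ij|neq_ij] := eqVneq i j.
  have absGG : (\int[P]_w `|(gamma_subordinator lambda Z N i t *
      gamma_subordinator lambda Z N j t) w|%:E =
      (lambda * t * (lambda * t + 1) / (a i * (1 - theta)) ^+ 2)%:E)%E.
    rewrite -(gamma_subordinator_abs_moment2
      lambda_gt0 theta_gt0 theta_lt1 a_gt0 Z_gamma N_nb ZN_indep t_ge0).
    by apply: eq_integral => w _; rewrite -eq_ij /= normrM.
  have [GGL EGG] := Lfun1_ae_ge0 mGG GG0 absGG.
  (* With [r = lambda t], the numerator is [r (r + 1) - r^2 = r]. *)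
  rewrite covarianceE// EGi EGj EGG -EFinM -EFinB -eq_ij; congr EFin.
  by rewrite mulr0 add0r mulr1; field; rewrite a_neq0 th0.
have absGG : (\int[P]_w `|(gamma_subordinator lambda Z N i t *
    gamma_subordinator lambda Z N j t) w|%:E =
    (lambda * t * (lambda * t + theta) /
     (a i * a j * (1 - theta) ^+ 2))%:E)%E.
  rewrite -(gamma_subordinator_abs_mul
    lambda_gt0 theta_gt0 theta_lt1 a_gt0 Z_gamma N_nb ZN_indep t_ge0 neq_ij).
  by apply: eq_integral => w _; rewrite /= normrM.
have [GGL EGG] := Lfun1_ae_ge0 mGG GG0 absGG.
(* Here the numerator is [r (r + theta) - r^2 = r theta], the source of the factor [theta] off the
   diagonal. *)
rewrite covarianceE// EGi EGj EGG -EFinM -EFinB; congr EFin.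
by rewrite mulr1 addr0; field; rewrite !a_neq0 th0.
Qed.
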